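(* Let $R$ be a unital associative ring, let $e \in R$ be an idempotent, and let $n$ be a nonnegative integer. The following conditions are equivalent: (1) $\operatorname{rank}_r e = n$; (2) $\operatorname{rank}_r e$ is finite and greater than $n-1$, and for every $r \in R$ either $\operatorname{rank}_r(er) < n$ or there exists $x \in \mathcal{U}(R)$ such that $er = ex$.
   Context: For a unital associative ring $R$, $\mathcal{U}(R)$ denotes the group of multiplicatively invertible elements of $R$. The right rank of an element $a \in R$, denoted $\operatorname{rank}_r a$, is the least nonnegative integer $k$ such that $a$ is contained in a sum of $k$ minimal right ideals of $R$, with the convention that the sum of zero minimal right ideals is $0$ (so $\operatorname{rank}_r a = 0$ if and only if $a=0$). If no such integer exists, then $\operatorname{rank}_r a = \infty$. *)

(* Defs.v *)
From mathcomp Require Import all_boot all_order all_algebra.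
From mathcomp Require Import boolp classical_sets constructive_ereal.
Set Implicit Arguments.
Unset Strict Implicit.
Unset Printing Implicit Defensive.
Import Order.TTheory GRing.Theory Num.Theory.

Local Open Scope classical_set_scope.
Local Open Scope ring_scope.

(* A [pzRingType] is an arbitrary unital associative ring; the zero ring is
   allowed.  MathComp's [GRing.unit] only exists for nonzero rings, hence the
   explicit description of the unit group. *)
Definition units (R : pzRingType) : set R :=
  [set x | exists y, x * y = 1 /\ y * x = 1].
Arguments units R : clear implicits.

Definition right_ideal (R : pzRingType) (I : set R) : Prop :=
  [/\ I 0,
      forall x y, I x -> I y -> I (x - y)
    & forall x r, I x -> I (x * r)].

Definition minimal_right_ideal (R : pzRingType) (I : set R) : Prop :=
  [/\ right_ideal I,
      I <> [set 0]
    & forall J, right_ideal J -> J `<=` I -> J = [set 0] \/ J = I].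

Definition ideal_sum (R : pzRingType) (k : nat) (I : 'I_k -> set R) : set R :=
  [set a | exists2 u : 'I_k -> R, forall i, I i (u i) & a = \sum_(i < k) u i].

(* The ideals of the family need not be distinct; since the rank is the least
   such [k], this does not affect it. *)
Definition in_sum_of_minimal (R : pzRingType) (a : R) (k : nat) : Prop :=
  exists2 I : 'I_k -> set R,
    forall i, minimal_right_ideal (I i) & ideal_sum I a.

(* The values lie in the extended integers, rather than the extended naturals,
   so that [n - 1] makes sense when [n = 0]. *)
Definition rank_r (R : pzRingType) (a : R) : \bar int :=
  match pselect (exists k, `[< in_sum_of_minimal a k >]) with
  | left ex_k => (Posz (ex_minn ex_k))%:E
  | right _ => +oo%E
  end.

(* Main.v *)
Require Import Defs.
From mathcomp Require Import all_boot all_order all_algebra.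
From mathcomp Require Import boolp classical_sets constructive_ereal.
Import Order.TTheory GRing.Theory Num.Theory.
Local Open Scope classical_set_scope.
Local Open Scope ring_scope.

Set Implicit Arguments.
Unset Strict Implicit.

(** The implication from (2) to (1) is a truncation argument.  If [e] has rank
    [m > n], write [e] as a sum of [m] elements of minimal right ideals inside
    [eR] and let [r] be the sum of the first [n] of them, so that [e * r = r].
    The rank of [r] is not below [n], since adding the remaining [m - n] terms
    must give rank [m].  So [r = e * x] with [x] invertible, and
    [e = r * x^-1] has rank at most [n], which is absurd.

    From (1) to (2), an irredundant expression of [e] makes the right ideal
    [eR] a direct sum of minimal right ideals generated by orthogonal
    idempotents ([idempotent_orthogonal_sum]).  There are two cases.

    - If [e] does not belong to [erR], then [erR] has a nonzero complement in
      [eR] which is spanned by some of the summands; the projection onto [erR]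
      along it kills these, and expresses [e * r] as a sum of fewer than [n]
      elements of minimal right ideals ([proper_submodule_sum]).

    - If [e = e * r * t], then left multiplication by [e * r] splits over
      [eR], and the existence of the unit [x] says that the kernel of this
      multiplication is isomorphic to [(1 - e)R], a cancellation property of
      modules of finite length ([right_multiple_unit]).  Summands are cancelled
      one at a time; the unit needed at each step ([atomic_unit]) is either
      block triangular or a reflection.

    Both facts about direct sums come from one exchange property
    ([irredundant_sum]).  The arguments are carried out on elements: the
    predicate [atomic] tells that [pR] is zero or minimal, and the rank is the
    least number of atomic elements with a given sum. *)

(** * Atomic elements and the rank *)

(** The right ideal [pR] is zero or minimal, as a condition on elements.  Zero is
    allowed in order to have stability under left and right multiplication. *)
Definition atomic (R : pzRingType) (p : R) : Prop :=
  forall s, p * s = 0 \/ exists t, p * s * t = p.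

Definition sum_of_atomic (R : pzRingType) (k : nat) (a : R) : Prop :=
  exists2 u : 'I_k -> R, forall i, atomic (u i) & a = \sum_i u i.

Lemma atomicMl (R : pzRingType) (x p : R) : atomic p -> atomic (x * p).
Proof.
move=> pP s; case: (pP s) => [ps0 | [t pst]]; first by left; rewrite -mulrA ps0 mulr0.
by right; exists t; rewrite -!mulrA [p * _]mulrA pst.
Qed.

Lemma atomicMr (R : pzRingType) (p x : R) : atomic p -> atomic (p * x).
Proof.
move=> pP s; case: (pP (x * s)) => [ps0 | [t pst]]; first by left; rewrite -mulrA.
by right; exists (t * x); rewrite -{2}pst !mulrA.
Qed.

Lemma minimal_right_ideal_atomic (R : pzRingType) (I : set R) (p : R) :
  minimal_right_ideal I -> I p -> atomic p.
Proof.
move=> [[_ IB IM] _ Imin] Ip s.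
have [ps0 | ps_neq0] := pselect (p * s = 0); [by left | right].
pose J : set R := [set z | exists t, z = p * s * t].
have Jideal : right_ideal J.
  split; first by exists 0; rewrite mulr0.
  - by move=> _ _ [t ->] [t' ->]; exists (t - t'); rewrite mulrBr.
  - by move=> _ z [t ->]; exists (t * z); rewrite mulrA.
have JI : J `<=` I by move=> _ [t ->]; rewrite -mulrA; apply: IM.
have Jps : J (p * s) by exists 1; rewrite mulr1.
case: (Imin J Jideal JI) => J_eq.
  by case: ps_neq0; move: Jps; rewrite J_eq.
by move: Ip; rewrite -J_eq => -[t pE]; exists t.
Qed.

Lemma atomic_minimal_right_ideal (R : pzRingType) (p : R) :
  atomic p -> p <> 0 -> minimal_right_ideal [set z | exists s, z = p * s].
Proof.
move=> pP p_neq0; split.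
- split; first by exists 0; rewrite mulr0.
  + by move=> _ _ [s ->] [t ->]; exists (s - t); rewrite mulrBr.
  + by move=> _ r [s ->]; exists (s * r); rewrite mulrA.
- move=> E; apply: p_neq0.
  have : [set z | exists s, z = p * s] p by exists 1; rewrite mulr1.
  by rewrite E.
move=> J [J0 _ JM] JI.
have [Jp | nJp] := pselect (J p).
  right; apply/seteqP; split=> // _ [s ->]; exact: JM.
left; apply/seteqP; split=> [z Jz /= | _ -> //].
have [s zE] := JI z Jz; case: (pP s) => [ps0 | [t pst]]; first by rewrite zE.
by case: nJp; rewrite -pst -zE; apply: JM.
Qed.

(** Zero terms are dropped: zero is atomic but lies in no prescribed minimal
    right ideal, and there may be none.  So fewer than [#|J|] ideals may be
    used. *)
Lemma atomic_sum_in_sum_of_minimal (R : pzRingType) (T : finType) (J : {set T})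
    (u : T -> R) (k : nat) :
  (forall i, atomic (u i)) -> (#|J| <= k)%N ->
  exists2 j, (j <= k)%N & in_sum_of_minimal (\sum_(i in J) u i) j.
Proof.
move=> uP Jk; pose K := [set i in J | `[< u i <> 0 >]]%SET.
exists #|K|.
  by apply: leq_trans Jk; apply: subset_leq_card; apply/fintype.subsetP=> i; rewrite inE => /andP[].
exists (fun j : 'I_#|K| => [set z | exists s, z = u (enum_val j) * s]).
  move=> j; apply: atomic_minimal_right_ideal => //.
  by have := enum_valP j; rewrite inE => /andP[_ /asboolP].
exists (fun j => u (enum_val j)); first by move=> j; exists 1; rewrite mulr1.
rewrite -big_enum_val [LHS](bigID (mem K)) /= [X in _ + X]big1 ?addr0.
  by apply: eq_bigl => i; rewrite inE; case: (i \in J).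
move=> i; rewrite inE => /andP[-> /=] /asboolP ui0.
exact: contrapT.
Qed.

Lemma rank_r_spec (R : pzRingType) (a : R) :
  rank_r a = +oo%E \/
  exists2 m : nat, rank_r a = m%:Z%:E & in_sum_of_minimal a m.
Proof.
rewrite /rank_r; case: pselect => [ex_k | _]; [right | by left].
by case: ex_minnP => m /asboolP am _; exists m.
Qed.

Lemma rank_r_le (R : pzRingType) (a : R) (k : nat) :
  in_sum_of_minimal a k -> (rank_r a <= k%:Z%:E)%E.
Proof.
move=> ak; rewrite /rank_r; case: pselect => [ex_k | []]; last by exists k; apply/asboolP.
by case: ex_minnP => m _ m_min; rewrite lee_fin lez_nat m_min //; apply/asboolP.
Qed.

Lemma in_sum_of_minimal_atomic (R : pzRingType) (a : R) (k : nat) :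
  in_sum_of_minimal a k -> sum_of_atomic k a.
Proof.
move=> [I Imin [u Iu ->]]; exists u => // i.
exact: minimal_right_ideal_atomic (Imin i) (Iu i).
Qed.

Lemma rank_r_sum_le (R : pzRingType) (T : finType) (J : {set T}) (u : T -> R)
    (k : nat) :
  (forall i, atomic (u i)) -> (#|J| <= k)%N ->
  (rank_r (\sum_(i in J) u i)%R <= k%:Z%:E)%E.
Proof.
move=> uP Jk; have [j jk /rank_r_le rj] := atomic_sum_in_sum_of_minimal uP Jk.
by apply: le_trans rj _; rewrite lee_fin lez_nat.
Qed.

Lemma rank_r_le_atomic (R : pzRingType) (a : R) (k : nat) :
  sum_of_atomic k a -> (rank_r a <= k%:Z%:E)%E.
Proof.
move=> [u uP ->].
have -> : \sum_i u i = \sum_(i in [set: 'I_k]%SET) u i.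
  by apply: eq_bigl => i; rewrite inE.
by apply: rank_r_sum_le => //; rewrite cardsT card_ord.
Qed.

Lemma rank_r_atomic (R : pzRingType) (a : R) (m : nat) :
  rank_r a = m%:Z%:E -> sum_of_atomic m a.
Proof.
move=> am; case: (rank_r_spec a) => [|[m']]; first by rewrite am.
by rewrite am => -[->] /in_sum_of_minimal_atomic.
Qed.

Lemma rank_r_lt_atomic (R : pzRingType) (a : R) (n : nat) :
  (rank_r a < n%:Z%:E)%E -> exists2 k, (k < n)%N & sum_of_atomic k a.
Proof.
case: (rank_r_spec a) => [-> // | [k ak /in_sum_of_minimal_atomic sk]].
by rewrite ak lte_fin ltz_nat => kn; exists k.
Qed.

Lemma sum_of_atomicD (R : pzRingType) (k l : nat) (a b : R) :
  sum_of_atomic k a -> sum_of_atomic l b -> sum_of_atomic (k + l) (a + b).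
Proof.
move=> [u uP ->] [v vP ->].
exists (fun i => match split i with inl i' => u i' | inr j => v j end).
  by move=> i; case: (split i).
rewrite big_split_ord /=; congr (_ + _); apply: eq_bigr => i _.
  by rewrite (unsplitK (inl i)).
by rewrite (unsplitK (inr i)).
Qed.

Lemma sum_of_atomicMr (R : pzRingType) (k : nat) (a x : R) :
  sum_of_atomic k a -> sum_of_atomic k (a * x).
Proof.
move=> [u uP ->]; exists (fun i => u i * x); last by rewrite mulr_suml.
by move=> i; apply: atomicMr.
Qed.

(** * Direct sums of minimal right ideals *)

(** Exchange property: in a minimal set [J] of summands such that [a] is in
    the sum of [N] and the [u i * R], a relation modulo [N] with a nonzero
    term [u j * s j] would put [u j] in the sum of [N] and the other terms,
    and [j] could be removed.  So [N] and the right ideals [u i * R] for [i] in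
    [J] form a direct sum. *)
Lemma irredundant_sum (R : pzRingType) (T : finType) (u : T -> R) (N : set R)
    (a : R) :
  (forall i, atomic (u i)) -> right_ideal N ->
  (exists s : T -> R, N (a - \sum_i u i * s i)) ->
  exists2 J : {set T},
    exists s : T -> R, N (a - \sum_(i in J) u i * s i)
    & forall s : T -> R, N (\sum_(i in J) u i * s i) ->
      forall i, i \in J -> u i * s i = 0.
Proof.
move=> uP [N0 NB NM] aT.
have ND x y : N x -> N y -> N (x + y).
  by move=> Nx Ny; rewrite -[y]opprK -[- y]add0r; apply: (NB) => //; apply: NB.
pose P (J : {set T}) := `[< exists s : T -> R, N (a - \sum_(i in J) u i * s i) >].
have PT : P [set: T]%SET.
  apply/asboolP; case: aT => s aT; exists s.
  suff -> : \sum_(i in [set: T]%SET) u i * s i = \sum_i u i * s i by [].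
  by apply: eq_bigl => i; rewrite inE.
have [J /minsetP[/asboolP PJ Jmin] _] := minset_exists PT.
exists J => // s Ns j Jj; apply: contrapT => usj.
case: (uP j (s j)) => // -[t ujE]; case: PJ => s' Ns'.
have /Jmin PJj : P (J :\ j)%SET.
  apply/asboolP; exists (fun i => s' i - s i * t * s' j).
  (* These coefficients result from adding the given relation, multiplied by
     [t * s' j], to [a - \sum_(i in J) u i * s' i]: this cancels the term of
     index [j], as [u j * s j * t = u j]. *)
  have -> : a - \sum_(i in (J :\ j)%SET) u i * (s' i - s i * t * s' j) =
            (a - \sum_(i in J) u i * s' i) + (\sum_(i in J) u i * s i) * (t * s' j).
    rewrite (big_setD1 j Jj) [X in _ + X * _](big_setD1 j Jj) /= mulrDl.
    rewrite !mulrA ujE [u j * s' j + _]addrC opprD !addrA subrK !mulr_suml -addrA.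
    congr (_ + _).
    rewrite -!sumrN -big_split; apply: eq_bigr => i _ /=.
    by rewrite mulrBr opprB addrC !mulrA.
  by apply: ND => //; apply: NM.
by have := PJj (subD1set J j) => /finset.setP/(_ j); rewrite !inE eqxx Jj.
Qed.

(** In an irredundant expression of [e] as a sum of elements [w i] of [eR], one
    has [w j = e * w j = \sum_i w i * w j], and both ends are expressions of
    [w j] in a direct sum.  Comparing the components gives orthogonality.  The
    redundant indices are kept, with [w i = 0]. *)
Lemma idempotent_orthogonal_sum (R : pzRingType) (e : R) (n : nat) :
  e * e = e -> sum_of_atomic n e ->
  exists w : 'I_n -> R,
    [/\ forall i, atomic (w i), e = \sum_i w i
      & forall i j, w i * w j = if i == j then w i else 0].
Proof.
move=> ee [v vP ev].
have [i|||J [s /eqP]] := @irredundant_sum R _ (fun i => e * v i) [set 0] e.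
- exact: atomicMl.
- by split=> [//|x y -> ->|x r ->]; rewrite ?subr0 ?mul0r.
- exists (fun=> 1); under eq_bigr do rewrite mulr1.
  by rewrite -mulr_sumr -ev ee subrr.
rewrite subr_eq0 => /eqP es Jdirect.
pose w i := if i \in J then e * v i * s i else 0.
have ew : e = \sum_i w i by rewrite {1}es big_mkcond.
have e_w i : e * w i = w i.
  by rewrite /w; case: ifP => _; rewrite ?mulr0 // !mulrA ee.
exists w; split=> // [i | i j].
  rewrite /w; case: ifP => _; first by apply/atomicMr/atomicMl.
  by move=> t; left; rewrite mul0r.
rewrite {1 3}/w; case: ifP => Ji; last by rewrite mul0r if_same.
have [Jj | nJj] := boolP (j \in J); last first.
  rewrite [w j]/w (negPf nJj) mulr0; case: eqP => // ij.
  by rewrite -ij Ji in nJj.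
have := Jdirect (fun i => s i * w j - if i == j then s i else 0) _ i Ji.
rewrite mulrBr mulrA => /(_ _)/eqP; rewrite subr_eq0 => E.
rewrite (eqP (E _)) /=; first by case: ifP => _; rewrite ?mulr0.
under eq_bigr do rewrite mulrBr mulrA.
rewrite sumrB -mulr_suml -es e_w (bigD1 j Jj) /= eqxx big1 ?addr0.
  by rewrite /w Jj subrr.
by move=> l /andP[_ /negPf->]; rewrite mulr0.
Qed.

(** Write [eR] as the sum of the [u i * R] with [u i = e * v i], and let
    [N = erR].  The complement of [N] in [eR] given by the exchange property is
    spanned by the [u i] with [i] in a set [J], which is not empty as [e] is not
    in [N].  Left multiplication by the component [x] of [e] in [N] fixes [e * r]
    and kills these [u i], so that [e * r] is the sum of the [x * u i * r] with
    [i] outside of [J]. *)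
Lemma proper_submodule_sum (R : pzRingType) (e r : R) (n : nat) :
  e * e = e -> sum_of_atomic n e -> (forall t, e <> e * r * t) ->
  (rank_r (e * r)%R < n%:Z%:E)%E.
Proof.
move=> ee [v vP ev] er_proper.
pose u i := e * v i; pose N : set R := [set z | exists t, z = e * r * t].
have eu : e = \sum_i u i by rewrite -mulr_sumr -ev ee.
have uP i : atomic (u i) by apply: atomicMl.
have [//|||J [s [t xE]] Jdirect] := @irredundant_sum R _ u N e.
- split; first by exists 0; rewrite mulr0.
  + by move=> _ _ [t ->] [t' ->]; exists (t - t'); rewrite mulrBr.
  + by move=> _ z [t ->]; exists (t * z); rewrite mulrA.
- exists (fun=> 1); under eq_bigr do rewrite mulr1.
  by rewrite -eu subrr; exists 0; rewrite mulr0.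
set y := \sum_(i in J) _ in xE; set x := e - y in xE.
have yMr z : y * z = \sum_(i in J) u i * (s i * z).
  by rewrite mulr_suml; apply: eq_bigr => i _; rewrite mulrA.
have x_er : x * (e * r) = e * r.
  rewrite mulrBl [e * (e * r)]mulrA ee yMr big1 ?subr0 //; apply: Jdirect.
  rewrite -yMr; exists (1 - t * (e * r)).
  by rewrite mulrBr mulr1 [_ * (t * _)]mulrA -xE [x * _]mulrBl [e * (e * r)]mulrA ee subKr.
have x_u j : j \in J -> x * u j = 0.
  move=> Jj; pose s' i := (if i == j then 1 else 0) - s i * u j.
  have xuE : x * u j = \sum_(i in J) u i * s' i.
    rewrite mulrBl yMr {1}/u mulrA ee -/(u j).
    under [RHS]eq_bigr do rewrite mulrBr.
    rewrite sumrB; congr (_ - _); rewrite (bigD1 j Jj) /= eqxx mulr1 big1 ?addr0 //.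
    by move=> i /andP[_ /negPf->]; rewrite mulr0.
  rewrite xuE big1 //; apply: Jdirect; rewrite -xuE xE.
  by exists (t * u j); rewrite mulrA.
have -> : e * r = \sum_(i in ~: J) x * u i * r.
  rewrite -{1}x_er {1}eu mulr_suml mulr_sumr (bigID (mem J)) /= big1 ?add0r.
    by apply: eq_big => [i | i _]; rewrite ?inE ?mulrA.
  by move=> i Ji; rewrite mulrA x_u // mul0r.
apply: le_lt_trans (rank_r_sum_le _ (leqnn _)) _.
  by move=> i; apply/atomicMr/atomicMl.
rewrite lte_fin ltz_nat cardsCs finset.setCK card_ord.
have [J0 | [j Jj]] := set_0Vmem J.
  by case: (er_proper t); rewrite -xE /x /y J0 big_set0 subr0.
have Jn : (0 < #|J|)%N by apply/card_gt0P; exists j.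
have n0 : (0 < n)%N by apply: leq_ltn_trans (ltn_ord j).
by rewrite ltn_subrL Jn n0.
Qed.

(** * Cancellation of direct summands *)

Lemma unitsM (R : pzRingType) (x y : R) : units R x -> units R y -> units R (x * y).
Proof.
move=> [x' [xx' x'x]] [y' [yy' y'y]]; exists (y' * x'); split.
  by rewrite mulrA -[x * y * y']mulrA yy' mulr1.
by rewrite mulrA -[y' * x' * x]mulrA x'x mulr1.
Qed.

(** Left multiplication by [c] is a surjection from [R] onto [pR], split by [d],
    and [y] is an automorphism of [R] with component [c] on [pR].  It maps the
    kernel of [c] isomorphically onto [(1 - p)R], so that the minimal summand
    [pR] is cancelled.  When [c * p] is not zero it is invertible in the division
    ring [pRp], and [1 - p + c] is block triangular.  Otherwise [d] can be
    corrected to have [p * d = 0], and the reflection that exchanges [p] and [d]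
    is suitable.  The condition on [q] holds because [y - 1] lies in [pR + dR]. *)
Lemma atomic_unit (R : pzRingType) (p c d : R) :
  p * p = p -> atomic p -> p * c = c -> c * d = p ->
  exists2 y, units R y &
    p * y = c /\ forall q, q * p = 0 -> q * d = 0 -> q * y = q.
Proof.
move=> pp pP pc cd; case: (pP (c * p)) => [|[t]]; rewrite mulrA pc => cp.
  (* As [h * g = 2p] and [p * h = h], the element [1 - g * h] is an involution,
     like a reflection [1 - v v^T] with [v^T v = 2]. *)
  pose d' := (1 - p) * d * p; pose g := p - d'; pose h := p - c.
  have pd' : p * d' = 0 by rewrite /d' !mulrA mulrBr mulr1 pp subrr !mul0r.
  have cd' : c * d' = p by rewrite /d' !mulrA mulrBr mulr1 cp subr0 cd pp.
  have hg : h * g = p + p by rewrite mulrBr !mulrBl pp cp pd' cd' subr0 sub0r opprK.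
  have ph : p * h = h by rewrite mulrBr pp pc.
  have yy : (1 - g * h) * (1 - g * h) = 1.
    have ghgh : g * h * (g * h) = g * h + g * h.
      by rewrite -mulrA [h * _]mulrA hg [(p + p) * h]mulrDl ph [g * (h + h)]mulrDr.
    by rewrite mulrBl mul1r [g * h * (1 - _)]mulrBr mulr1 ghgh opprB addrK subrK.
  exists (1 - g * h); first by exists (1 - g * h).
  split; first by rewrite mulrBr mulr1 mulrA [p * g]mulrBr pp pd' subr0 ph subKr.
  move=> q qp qd; have qg : q * g = 0.
    by rewrite mulrBr qp /d' !mulrA mulrBr mulr1 qp subr0 qd mul0r subrr.
  by rewrite mulrBr mulr1 mulrA qg mul0r subr0.
(* [w] is the inverse of [c * p] in [pRp]; the inverse of [o + c], which is
   block triangular for [1 = p + o], follows from it. *)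
pose w := p * t * p; pose o := 1 - p.
have cw : c * w = p by rewrite /w !mulrA cp pp.
have pw : p * w = w by rewrite /w !mulrA pp.
have wp : w * p = w by rewrite /w -mulrA pp.
have wcp : w * c * p = p.
  case: (pP w) => [|[t']]; rewrite pw => wE; first by rewrite -cw wE mulr0 !mulr0.
  have cpE : c * p = p * t' by rewrite -{1}wE [c * (w * t')]mulrA cw.
  by rewrite -mulrA cpE mulrA wp.
have op : o * p = 0 by rewrite mulrBl mul1r pp subrr.
have po : p * o = 0 by rewrite mulrBr mulr1 pp subrr.
have oo : o * o = o by rewrite {1}/o mulrBl mul1r po subr0.
have oc : o * c = 0 by rewrite -pc mulrA op mul0r.
have ow : o * w = 0 by rewrite -pw mulrA op mul0r.
have wo : w * o = 0 by rewrite -wp -mulrA po mulr0.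
have o_p : o + p = 1 by rewrite subrK.
have wcE : w * c = w * c * o + p by rewrite -[LHS]mulr1 -o_p mulrDr wcp.
clearbody o w.
exists (o + c).
  exists (o + w - w * c * o); split.
    rewrite mulrDl !mulrBr !mulrDr oo ow cw !mulrA ow cw pc !mul0r subr0 addr0.
    by rewrite [c * o + p]addrC addrK.
  rewrite mulrBl !mulrDl !mulrDr oo oc wo addr0 add0r -[w * c * o * o]mulrA oo.
  by rewrite -[w * c * o * c]mulrA oc mulr0 addr0 {1}wcE [_ + p]addrC addrA addrK.
split; first by rewrite mulrDr po pc add0r.
move=> q qp _; have qo : q * o = q by rewrite -{2}[q]mulr1 -o_p mulrDr qp addr0.
by rewrite mulrDr qo -pc mulrA qp mul0r addr0.
Qed.

(** Cancellation of [eR], where [e] is the sum of the [w i].  The unit is a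
    product with one factor for each summand: when [x] already agrees with [a] on
    the components [w j] for [j] in a list [l], the element [w i * a * x^-1]
    satisfies the assumptions of [atomic_unit] for [w i], and the new factor [y]
    has [w j * y = w j] for [j] in [l]. *)
Lemma right_multiple_unit (R : pzRingType) (T : finType) (w : T -> R) (a b : R) :
  (forall i, atomic (w i)) ->
  (forall i j, w i * w j = if i == j then w i else 0) ->
  a * b = \sum_i w i ->
  exists2 x, units R x & (\sum_i w i) * a = (\sum_i w i) * x.
Proof.
move=> wP ww ab.
have w_ab i : w i * (a * b) = w i.
  rewrite ab mulr_sumr (bigD1 i) //= ww eqxx big1 ?addr0 // => j /negPf ij.
  by rewrite ww eq_sym ij.
have [x xU xP] : exists2 x, units R x & {in enum T, forall j, w j * x = w j * a}.
  elim: (enum T) => [|i l [x [x' [xx' x'x]] IH]]; first by exists 1 => //; exists 1; rewrite mulr1.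
  have [il | nil] := boolP (i \in l).
    exists x; first by exists x'.
    by move=> j; rewrite inE => /orP[/eqP-> |]; apply: IH.
  have [|//|||y yU [wy y_fix]] := @atomic_unit R (w i) (w i * (a * x')) (x * b * w i).
  - by rewrite ww eqxx.
  - by rewrite mulrA ww eqxx.
  - rewrite -mulrA !mulrA -[_ * x' * x]mulrA x'x mulr1 -[w i * a * b]mulrA w_ab.
    by rewrite ww eqxx.
  exists (y * x); first by apply: unitsM => //; exists x'.
  move=> j; rewrite inE => /orP[/eqP-> | jl].
    by rewrite mulrA wy -!mulrA x'x mulr1.
  have ji : j == i = false by apply: contraNF nil => /eqP <-.
  have wji : w j * w i = 0 by rewrite ww ji.
  rewrite mulrA y_fix ?IH //.
  by rewrite !mulrA IH // -[w j * a * b]mulrA w_ab.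
exists x => //; rewrite !mulr_suml; apply: eq_bigr => i _.
by rewrite xP // mem_enum.
Qed.

Theorem theorem4p6 (R : pzRingType) (e : R) (he : e * e = e) (n : nat) :
  rank_r e = (n%:Z)%:E <->
  [/\ rank_r e \is a fin_num,
      ((n%:Z - 1)%:E < rank_r e)%E
    & forall r : R,
        (rank_r (e * r) < (n%:Z)%:E)%E \/
        exists2 x : R, units R x & e * r = e * x].
Proof.
split=> [en | [e_fin ne er]].
  have /(idempotent_orthogonal_sum he)[w [wP ew ww]] := rank_r_atomic en.
  split; first by rewrite en.
    by rewrite en lte_fin ltrBlDr ltrDl.
  move=> r; have [[t ert] | er_proper] := pselect (exists t, e = e * r * t).
    right; have [|x xU] := @right_multiple_unit R _ w (e * r) t wP ww.
      by rewrite -ew.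
    by rewrite -ew mulrA he => erx; exists x.
  left; apply: proper_submodule_sum (rank_r_atomic en) _ => // t ert.
  by apply: er_proper; exists t.
case: (rank_r_spec e) => [e_oo | [m em _]]; first by rewrite e_oo in e_fin.
have nm : (n <= m)%N by move: ne; rewrite em lte_fin ltrBlDr ltzD1.
rewrite em; congr (_%:Z%:E); apply/eqP; rewrite eqn_leq nm andbT leqNgt.
apply/negP => n_lt_m.
have [v vP ev] := rank_r_atomic em.
have m_min k : sum_of_atomic k e -> (m <= k)%N.
  by move=> /rank_r_le_atomic; rewrite em lee_fin lez_nat.
move: nm v vP ev n_lt_m m_min => /subnKC <-; set p := (m - n)%N => v vP ev n_lt m_min.
pose r := \sum_(i < n) e * v (lshift p i).
have r_sum : sum_of_atomic n r by exists (fun i => e * v (lshift p i)) => // i; apply: atomicMl.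
have e_r : e * r = r by rewrite /r -mulr_sumr mulrA he.
case: (er r) => [|[x [x' [xx' _]]]]; rewrite e_r.
  move=> /rank_r_lt_atomic[k kn rk].
  have /m_min : sum_of_atomic (k + p) e.
    have -> : e = r + \sum_(j < p) e * v (rshift n j).
      by rewrite -[LHS]he {2}ev mulr_sumr big_split_ord.
    apply: sum_of_atomicD => //; exists (fun j => e * v (rshift n j)) => // j.
    exact: atomicMl.
  by rewrite leq_add2r leqNgt kn.
move=> rx; have /m_min : sum_of_atomic n e.
  by rewrite -[e]mulr1 -xx' mulrA -rx; apply: sum_of_atomicMr.
by rewrite leqNgt n_lt.
Qed.
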